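(* Let $n\ge 2$ and let $S_n$ denote the star graph with $n$ vertices; that is, the connected graph with one central vertex of degree $n-1$, adjacent to $n-1$ vertices of degree $1$. Then $C_{S_n}=1+\sqrt{n-1}$.
   Context: For a metric space $(X,d)$, write $B(x,r)=\{y\in X: d(x,y)<r\}$ for $x\in X$, $r>0$. All measures $\mu$ on $X$ considered are Borel regular and non-trivial in the sense that $0<\mu(B(x,r))<\infty$ for every $x\in X$ and $r>0$. Such a $\mu$ is called doubling if there is a constant $C\ge 1$ with $\mu(B(x,2r))\le C\mu(B(x,r))$ for all $x\in X$, $r>0$; in that case $C_\mu=\sup_{x\in X,\,r>0}\frac{\mu(B(x,2r))}{\mu(B(x,r))}$. The least doubling constant of $(X,d)$ is $C_{(X,d)}=\inf\{C_\mu:\mu\text{ doubling measure on }(X,d)\}$, with $C_{(X,d)}=\infty$ if no doubling measure exists on $(X,d)$. For a simple connected graph $G$, $C_G$ denotes $C_{(V(G),d)}$, where $V(G)$ is the vertex set and $d$ is the shortest path distance (each edge has length 1). *)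

(* Defs.v *)
From HB Require Import structures.
From mathcomp Require Import all_boot all_order all_algebra.
From mathcomp Require Import all_classical all_reals all_analysis.

Set Implicit Arguments.
Unset Strict Implicit.
Unset Printing Implicit Defensive.

Import Order.TTheory GRing.Theory Num.Theory.

Local Open Scope classical_set_scope.
Local Open Scope ring_scope.

Section LeastDoublingConstant.
Context {R : realType} (X : metricType R).

Definition borel_set : set (set X) := <<s [set U : set X | open U] >>.

(* "Measure" is meant in the sense of metric-measure geometry, i.e. an outer
   measure on all subsets, for which every Borel set is (Caratheodory)
   measurable and every set has a Borel hull of the same measure. *)
Definition borel_regular (mu : {outer_measure set X -> \bar R}) : Prop :=
  (forall B, borel_set B -> mu.-caratheodory B) /\
  (forall A, exists B, [/\ borel_set B, A `<=` B & mu B = mu A]).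

Definition nontrivial_on_balls (mu : {outer_measure set X -> \bar R}) : Prop :=
  forall (x : X) (r : R), 0 < r -> (0 < mu (ball x r) < +oo)%E.

Definition doubling_measure (mu : {outer_measure set X -> \bar R}) : Prop :=
  [/\ borel_regular mu, nontrivial_on_balls mu &
      exists2 C : R, 1 <= C & forall (x : X) (r : R), 0 < r ->
        (mu (ball x (2 * r)) <= C%:E * mu (ball x r))%E].

Definition doubling_constant (mu : {outer_measure set X -> \bar R}) : \bar R :=
  ereal_sup [set q | exists x : X, exists2 r : R, 0 < r &
    q = (mu (ball x (2 * r)) / mu (ball x r))%E].

(* [ereal_inf set0 = +oo], as required when there is no doubling measure. *)
Definition least_doubling_constant : \bar R :=
  ereal_inf [set doubling_constant mu | mu in [set mu | doubling_measure mu]].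

End LeastDoublingConstant.

Arguments least_doubling_constant {R} X.

Record connected_graph := ConnectedGraph {
  vertex :> choiceType;
  adj : rel vertex;
  adj_sym : symmetric adj;
  adj_irr : irreflexive adj;
  adj_connected : forall x y, exists2 p : seq vertex, path adj x p & last x p = y
}.

Section GraphDistance.
Variable G : connected_graph.

(* [size p] is the number of edges of the walk [x :: p]. *)
Definition walk_of_length (x y : G) (n : nat) : Prop :=
  exists p : seq G, [/\ path (@adj G) x p, last x p = y & size p = n].

Lemma walk_exists (x y : G) : exists n, `[< walk_of_length x y n >].
Proof.
by have [p xp py] := adj_connected x y; exists (size p); apply/asboolP; exists p.
Qed.

Definition gdist (x y : G) : nat := ex_minn (walk_exists x y).

Lemma gdist_le (x y : G) (p : seq G) :
  path (@adj G) x p -> last x p = y -> (gdist x y <= size p)%N.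
Proof.
move=> xp py; rewrite /gdist; case: ex_minnP => m _; apply.
by apply/asboolP; exists p.
Qed.

Lemma gdist_walk (x y : G) : walk_of_length x y (gdist x y).
Proof. by rewrite /gdist; case: ex_minnP => m /asboolP. Qed.

Lemma gdistxx (x : G) : gdist x x = 0%N.
Proof. by apply/eqP; rewrite -leqn0; apply: (@gdist_le x x [::]). Qed.

Lemma gdist_eq0 (x y : G) : gdist x y = 0%N -> x = y.
Proof. by have [p [_ <- <-]] := gdist_walk x y => /size0nil ->. Qed.

Lemma gdist_sym_le (x y : G) : (gdist y x <= gdist x y)%N.
Proof.
have [p [xp py <-]] := gdist_walk x y.
rewrite -(size_belast x p) -size_rev; apply: gdist_le.
  rewrite -py rev_path (eq_path (e' := @adj G)) // => u v; exact: adj_sym.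
by case: p {xp} py => [<- //|a p _]; rewrite /= rev_cons last_rcons.
Qed.

Lemma gdist_sym (x y : G) : gdist x y = gdist y x.
Proof. by apply/eqP; rewrite eqn_leq !gdist_sym_le. Qed.

Lemma gdist_triangle (y x z : G) : (gdist x z <= gdist x y + gdist y z)%N.
Proof.
have [p [xp py <-]] := gdist_walk x y; have [q [yq qz <-]] := gdist_walk y z.
rewrite -size_cat; apply: gdist_le; last by rewrite last_cat py.
by rewrite cat_path xp py.
Qed.

End GraphDistance.

Definition graph_space (R : realType) (G : connected_graph) : Type := vertex G.

Section GraphMetric.
Variables (R : realType) (G : connected_graph).

Definition graph_mdist (x y : graph_space R G) : R := (@gdist G x y)%:R.

Fact graph_mdistxx x : graph_mdist x x = 0.
Proof. by rewrite /graph_mdist gdistxx. Qed.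

Fact graph_mdist_eq0 x y : graph_mdist x y = 0 -> x = y.
Proof. by move/eqP; rewrite pnatr_eq0 => /eqP/gdist_eq0. Qed.

Fact graph_mdist_sym x y : graph_mdist x y = graph_mdist y x.
Proof. by rewrite /graph_mdist gdist_sym. Qed.

Fact graph_mdist_triangle y x z :
  graph_mdist x z <= graph_mdist x y + graph_mdist y z.
Proof. by rewrite -natrD ler_nat gdist_triangle. Qed.

HB.instance Definition _ := Choice.copy (graph_space R G) (vertex G).
HB.instance Definition _ := isMetric.Build R (graph_space R G)
  graph_mdistxx graph_mdist_eq0 graph_mdist_sym graph_mdist_triangle.

End GraphMetric.

Definition graph_least_doubling_constant (R : realType) (G : connected_graph)
  : \bar R := least_doubling_constant (graph_space R G).

Definition has_degree (G : connected_graph) (x : G) (k : nat) : Prop :=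
  ([set y | adj x y] #= `I_k)%card.

(* For [n = 2] either vertex may serve as the centre. *)
Definition star_graph (n : nat) (G : connected_graph) : Prop :=
  ([set: G] #= `I_n)%card /\
  exists2 c : G, has_degree c n.-1 &
    forall x : G, x <> c -> adj c x /\ has_degree x 1.

(* Main.v *)
(* Weigh the centre by [1] and the [m = n - 1] leaves by [t]: doubling the unit
   ball at the centre costs [1 + m t], doubling the unit ball at a leaf costs
   [1 + 1 / t], and [t = 1 / sqrt m] balances the two.  Conversely, for an
   arbitrary doubling measure with constant [d], of mass [k] at the centre and
   [l] on the leaves altogether, the centre gives [l <= (d - 1) k] and summing
   the bounds at the leaves gives [m k <= (d - 1) l]; hence [m <= (d - 1)^2]. *)
Require Import Defs.
From HB Require Import structures.
From mathcomp Require Import all_boot all_order all_algebra.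
From mathcomp Require Import all_classical all_reals all_analysis.
Set Implicit Arguments.
Unset Strict Implicit.
Unset Printing Implicit Defensive.
Import Order.TTheory GRing.Theory Num.Theory.
Local Open Scope classical_set_scope.
Local Open Scope ring_scope.

(** * Finite weighted counting measures *)

Section WeightedCounting.
Context {R : realType} {T : Type} (s : seq T) (w : T -> {nonneg R}).

(** A finite sum of weighted Dirac masses. It is evaluated on all subsets because measures are taken
    here as outer measures. *)
Definition weighted_count (A : set T) : \bar R :=
  (\sum_(x <- s) (w x)%:num * \1_A x)%:E.

Let term_ge0 (A : set T) x : 0 <= (w x)%:num * \1_A x :> R.
Proof. by rewrite mulr_ge0. Qed.

Let weighted_count0 : weighted_count set0 = 0%E.
Proof. by rewrite /weighted_count big1// => x _; rewrite indic0 mulr0. Qed.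

Let weighted_count_ge0 A : (0 <= weighted_count A)%E.
Proof. by rewrite lee_fin sumr_ge0. Qed.

Let le_weighted_count :
  {homo weighted_count : A B / A `<=` B >-> (A <= B)%E}.
Proof.
move=> A B AB; rewrite lee_fin ler_sum// => x _; rewrite ler_wpM2l//.
rewrite !indicE ler_nat; case: (boolP (x \in A)) => //.
by move=> /set_mem /AB /mem_set ->.
Qed.

(** After exchanging the series with the finite sum, each point is treated alone: if it lies in the
    union it lies in some [F i], and that one term of the series already pays for it. *)
Let weighted_count_sigma_subadditive : sigma_subadditive weighted_count.
Proof.
move=> F; rewrite /weighted_count.
under eq_eseriesr do rewrite -sumEFin.
rewrite nneseries_sum; last by move=> *; rewrite lee_fin.
rewrite -sumEFin lee_sum// => x _.
have [/set_mem[i _ Fix]|nFx] := boolP (x \in \bigcup_n F n); last first.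
  by rewrite indicE (negbTE nFx) mulr0 nneseries_ge0.
(* Truncating at [i.+1] makes the term of index [i] the last one, so that [big_nat_recr] isolates
   it. *)
apply: le_trans (nneseries_lim_ge i.+1 _) => /=; last first.
  by move=> *; rewrite lee_fin.
rewrite big_nat_recr//= indicE mem_set; last by exists i.
by rewrite [in X in (_ + X)%E]indicE (mem_set Fix) leeDr// sume_ge0.
Qed.

HB.instance Definition _ := isOuterMeasure.Build R T weighted_count
  weighted_count0 weighted_count_ge0 le_weighted_count
  weighted_count_sigma_subadditive.

(** The splitting holds term by term, as each point lies in exactly one of [A] and its
    complement. *)
Lemma caratheodory_weighted_count (A : set T) :
  caratheodory_measurable weighted_count A.
Proof.
move=> B; rewrite /weighted_count -EFinD -big_split/=; congr EFin.
apply: eq_bigr => x _; rewrite -mulrDr; congr (_ * _).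
rewrite !indicE !in_setI in_setC.
by case: (x \in A); rewrite ?andbT ?andbF ?addr0 ?add0r.
Qed.

End WeightedCounting.

Lemma weighted_count1 {R : realType} {T : eqType} (s : seq T)
    (w : T -> {nonneg R}) (x : T) :
  uniq s -> x \in s -> weighted_count s w [set x] = (w x)%:num%:E.
Proof.
move=> us xs; rewrite /weighted_count (bigD1_seq x)//= big1 => [|y yx].
  by rewrite indicE mem_set// mulr1 addr0.
by rewrite indicE in_set1 (negbTE yx) mulr0.
Qed.

(** * Finite additivity, and doubling bounds without quotients *)

Section FiniteAdditivity.
Context {R : realType} {T : eqType} (mu : {outer_measure set T -> \bar R}).
Hypothesis mu_caratheodory : forall A : set T, mu.-caratheodory A.

Lemma outer_measure_setU1 (x : T) (A : set T) :
  ~ A x -> mu (x |` A) = (mu [set x] + mu A)%E.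
Proof.
move=> nAx; rewrite (mu_caratheodory [set x]); congr (mu _ + mu _)%E.
  by apply/seteqP; split=> [y []//|y /= ->]; split=> //; left.
apply/seteqP; split=> [y [[]//]|y Ay]; split; first by right.
by move=> /= yx; rewrite yx in Ay.
Qed.

Lemma outer_measure_seq (l : seq T) :
  uniq l -> mu [set` l] = (\sum_(x <- l) mu [set x])%E.
Proof.
elim: l => [_|x l IHl /= /andP[xl ul]].
  by rewrite big_nil set_nil outer_measure0.
rewrite big_cons -IHl// -outer_measure_setU1; last exact/negP.
congr (mu _); apply/seteqP; split=> y /=; rewrite in_cons.
  by move=> /orP[/eqP|]; [left|right].
by move=> [->|->]; rewrite ?eqxx ?orbT.
Qed.

End FiniteAdditivity.

(** Balls have positive finite mass, so the extended-real quotient is a genuine one and its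
    denominator can be cleared. *)
Lemma doubling_constant_leP {R : realType} {X : metricType R}
    (mu : {outer_measure set X -> \bar R}) (d : R) :
  nontrivial_on_balls mu ->
  (doubling_constant mu <= d%:E)%E <->
  forall (x : X) (r : R), 0 < r ->
    (mu (ball x (2 * r)) <= d%:E * mu (ball x r))%E.
Proof.
move=> mu_balls.
have ratioE x r : 0 < r ->
    (mu (ball x (2 * r)) / mu (ball x r) <= d%:E)%E =
    (mu (ball x (2 * r)) <= d%:E * mu (ball x r))%E.
  move=> /(mu_balls x)/andP[]; case: (mu (ball x r)) => // q q0 _.
  by rewrite inver gt_eqF// lee_pdivrMr.
split=> [mu_le x r r0|mu_le].
  rewrite -ratioE//; apply: le_trans mu_le; apply: ereal_sup_ubound.
  by exists x; exists r.
by apply: ge_ereal_sup => _ [x [r r0 ->]]; rewrite ratioE//; exact: mu_le.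
Qed.

(** * Balls and Borel sets in a graph *)

Section GraphBalls.
Context {R : realType} {G : connected_graph}.
Implicit Types x y : graph_space R G.

Lemma ball_graph x (r : R) y : ball x r y <-> (@gdist G x y)%:R < r.
Proof. by rewrite ballEmdist. Qed.

Lemma gdist_le1 x y : (@gdist G x y <= 1)%N <-> y = x \/ @adj G x y.
Proof.
split=> [|[->|xy]]; last 2 first.
- by rewrite gdistxx.
- by apply: (@gdist_le _ _ _ [:: y]) => //=; rewrite xy.
have [p [+ <- <-]] := gdist_walk (x : G) y.
by case: p => [|z [|//]] /=; [left|rewrite andbT; right].
Qed.

Lemma ball_graph1 x : ball x (1 : R) = [set x].
Proof.
apply/seteqP; split=> y; rewrite ball_graph.
  by rewrite (ltr_nat R _ 1) ltnS leqn0 => /eqP/gdist_eq0.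
by move=> ->; rewrite gdistxx.
Qed.

Lemma open_graph (A : set (graph_space R G)) : open A.
Proof.
rewrite openE => x Ax; apply/nbhs_ballP; exists 1 => //=.
by rewrite ball_graph1 => _ ->.
Qed.

Lemma borel_set_graph (A : set (graph_space R G)) : borel_set A.
Proof. by apply: sub_sigma_algebra; exact: open_graph. Qed.

(** Distances are natural numbers, so unit balls are singletons and the topology is discrete. Every
    set is then Borel, and is its own Borel hull. *)
Lemma borel_regular_graph
    (mu : {outer_measure set (graph_space R G) -> \bar R}) :
  borel_regular mu <-> forall A, mu.-caratheodory A.
Proof.
split=> [[mu_borel _] A|mu_car]; first exact: mu_borel (borel_set_graph A).
split=> // A; exists A; split=> //; exact: borel_set_graph.
Qed.

End GraphBalls.

(** * Balls in a star, and the lower bound *)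

Section Star.
Context {R : realType} {G : connected_graph}.
Local Notation X := (graph_space R G).
Variables (c : X) (leaves : seq X).
Hypothesis uniq_leaves : uniq leaves.
Hypothesis center_notin : c \notin leaves.
Hypothesis mem_leaves : forall x : X, x != c -> x \in leaves.
Hypothesis center_adj : forall x : X, x != c -> @adj G c x.
Hypothesis leaf_adj : forall x y : X, x != c -> @adj G x y -> y = c.

Let m : R := (size leaves)%:R.

Lemma star_setE : [set: X] = [set` c :: leaves].
Proof.
apply/seteqP; split=> // x _ /=; rewrite in_cons; case: eqVneq => //=.
exact: mem_leaves.
Qed.

Lemma leaf_neq_center x : x \in leaves -> x != c.
Proof. by apply: contraTneq => ->. Qed.

Lemma gdist_center_le1 (x : X) : (@gdist G x c <= 1)%N.
Proof.
rewrite gdist_sym; apply/gdist_le1; have [->|xc] := eqVneq x c; first by left.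
by right; exact: center_adj.
Qed.

Lemma ball_star_gt1 (x : X) (r : R) : 1 < r -> ball x r c.
Proof.
move=> r1; apply/ball_graph; apply: le_lt_trans r1.
by rewrite lern1 gdist_center_le1.
Qed.

Lemma ball_center2 : ball c (2 : R) = setT.
Proof.
apply/seteqP; split=> // x _; apply/ball_graph.
by rewrite (ltr_nat R _ 2) ltnS gdist_sym gdist_center_le1.
Qed.

Lemma ball_leaf2 (x : X) : x != c -> ball x (2 : R) = x |` [set c].
Proof.
move=> xc; apply/seteqP; split=> [y /ball_graph|y [->|->]].
- rewrite (ltr_nat R _ 2) ltnS => /gdist_le1[->|/(leaf_adj xc) ->].
  + by left.
  + by right.
- exact: ballxx.
- by apply: ball_star_gt1; rewrite ltr1n.
Qed.

Lemma doubling_constant_star_ge (mu : {outer_measure set X -> \bar R}) (d : R) :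
  doubling_measure mu -> (doubling_constant mu <= d%:E)%E ->
  1 + Num.sqrt m <= d.
Proof.
move=> [/borel_regular_graph mu_car mu_balls _].
move=> /(doubling_constant_leP _ mu_balls) mu_d.
pose a x := fine (mu [set x]).
(* A singleton is a unit ball, so its mass is a positive real. All estimates below can therefore be
   made in [R], taking radius 1 in the doubling inequality. *)
have /all_and2[aE a0] x : mu [set x] = (a x)%:E /\ 0 < a x.
  have := mu_balls x 1 ltr01; rewrite ball_graph1 /a.
  by case: (mu [set x]) => [q /andP[]|/andP[]|/andP[]]; rewrite ?lte_fin.
have leaf_le x : x \in leaves -> a c <= (d - 1) * a x.
  move=> /leaf_neq_center xc.
  have := mu_d x 1 ltr01; rewrite mulr1 ball_leaf2// ball_graph1.
  rewrite outer_measure_setU1//; last by move=> /= xc'; rewrite xc' eqxx in xc.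
  by rewrite !aE -EFinD -EFinM lee_fin mulrBl mul1r lerBrDl.
have center_le : \sum_(x <- leaves) a x <= (d - 1) * a c.
  have := mu_d c 1 ltr01; rewrite mulr1 ball_center2 ball_graph1 star_setE.
  rewrite outer_measure_seq//= ?center_notin// big_cons.
  under eq_bigr do rewrite aE.
  by rewrite aE sumEFin -EFinD -EFinM lee_fin mulrBl mul1r lerBrDl.
(* The left side is the constant [a c] summed over the leaves, so [leaf_le] applies termwise. *)
have sum_ge : m * a c <= (d - 1) * \sum_(x <- leaves) a x.
  rewrite mulr_sumr /m mulr_natl -iter_addr_0 -count_predT -big_const_seq.
  by rewrite !big_seq ler_sum.
have d1 : 0 <= d - 1.
  rewrite -(pmulr_lge0 _ (a0 c)); apply: le_trans center_le.
  by rewrite sumr_ge0// => x _; exact: ltW.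
(* Writing [d - 1] as the root of its square, which needs [d1], leaves [m <= (d - 1) ^+ 2]. This
   follows by chaining [sum_ge] with [center_le] and cancelling [a c]. *)
rewrite -lerBrDl -(ger0_norm d1) -sqrtr_sqr ler_wsqrtr//.
rewrite -(ler_pM2r (a0 c)); apply: le_trans sum_ge _.
by rewrite expr2 -mulrA ler_wpM2l.
Qed.

(** * Upper bound: the balanced weights *)

Hypothesis leaves_gt0 : 0 < m.

Let t : R := (Num.sqrt m)^-1.
Let t_gt0 : 0 < t. Proof. by rewrite invr_gt0 sqrtr_gt0. Qed.

Let w (x : X) : {nonneg R} := if x == c then 1%:nng else NngNum (ltW t_gt0).
Let mu : {outer_measure set X -> \bar R} := weighted_count (c :: leaves) w.

Let mu1 x : mu [set x] = (w x)%:num%:E.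
Proof.
apply: weighted_count1; first by rewrite /= center_notin.
by have: [set: X] x by []; rewrite star_setE.
Qed.

Let wc : (w c)%:num = 1.
Proof. by rewrite /w eqxx. Qed.

Let wl x : x != c -> (w x)%:num = t.
Proof. by rewrite /w => /negbTE ->. Qed.

Let mu_car A : mu.-caratheodory A.
Proof. exact: caratheodory_weighted_count. Qed.

Let mu_ge (A : set X) x : A x -> ((w x)%:num%:E <= mu A)%E.
Proof. by move=> Ax; rewrite -mu1 le_outer_measure// => _ ->. Qed.

Let sqrt_mt : Num.sqrt m * t = 1.
Proof. by rewrite divff// gt_eqF// sqrtr_gt0. Qed.

(** The leaves weigh [m * t] together, which is [Num.sqrt m] by the choice of [t]. *)
Let mu_setT : mu setT = (1 + Num.sqrt m)%:E.
Proof.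
rewrite star_setE outer_measure_seq/= ?center_notin//.
rewrite big_cons mu1 wc; under eq_bigr do rewrite mu1.
rewrite sumEFin -EFinD; congr (1 + _)%:E.
rewrite (eq_big_seq (fun=> t)) => [|x /leaf_neq_center/wl //].
rewrite big_const_seq count_predT iter_addr_0 -mulr_natl -/m.
by rewrite -{1}(sqr_sqrtr (ltW leaves_gt0)) expr2 -mulrA sqrt_mt mulr1.
Qed.

Let mu_nontrivial : nontrivial_on_balls mu.
Proof.
move=> x r r0; rewrite ltry andbT.
apply: lt_le_trans (mu_ge (ballxx x r0)).
by rewrite lte_fin /w; case: ifP.
Qed.

(** A ball containing the centre has mass at least 1, while the whole space has mass
    [1 + Num.sqrt m]. What remains is a leaf with [r <= 1]: the doubled ball lies in the leaf plus
    the centre, of mass [t + 1], which equals [(1 + Num.sqrt m) * t]. *)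
Let mu_doubling (x : X) (r : R) : 0 < r ->
  (mu (ball x (2 * r)) <= (1 + Num.sqrt m)%:E * mu (ball x r))%E.
Proof.
move=> r0; have K0 : (0 <= (1 + Num.sqrt m)%:E)%E.
  by rewrite lee_fin addr_ge0// sqrtr_ge0.
have center_in : ball x r c ->
    (mu (ball x (2 * r)) <= (1 + Num.sqrt m)%:E * mu (ball x r))%E.
  move=> /mu_ge; rewrite wc => /(lee_wpmul2l K0); apply: le_trans.
  by rewrite mule1 -mu_setT le_outer_measure.
have [r1|r1] := ltP 1 r; first exact/center_in/ball_star_gt1.
have [xc|xc] := eqVneq x c.
  by apply: center_in; rewrite xc; exact: ballxx.
apply: le_trans (lee_wpmul2l K0 (mu_ge (ballxx x r0))).
apply: (@le_trans _ _ (mu (ball x 2))).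
  by apply: le_outer_measure; apply: le_ball; rewrite -[leRHS]mulr1 ler_pM2l.
rewrite ball_leaf2// outer_measure_setU1//; last first.
  by move=> /= xc'; rewrite xc' eqxx in xc.
by rewrite !mu1 wc wl// -EFinD -EFinM lee_fin mulrDl mul1r sqrt_mt.
Qed.

Lemma doubling_measure_star : exists2 mu : {outer_measure set X -> \bar R},
  doubling_measure mu & (doubling_constant mu <= (1 + Num.sqrt m)%:E)%E.
Proof.
exists mu; last exact/doubling_constant_leP.
split=> //; first exact/borel_regular_graph.
by exists (1 + Num.sqrt m) => //; rewrite lerDl sqrtr_ge0.
Qed.

Lemma least_doubling_constant_star :
  least_doubling_constant X = (1 + Num.sqrt m)%:E.
Proof.
apply/eqP; rewrite eq_le; apply/andP; split.
  have [nu nu_doubling] := doubling_measure_star; apply: le_trans.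
  by apply: ereal_inf_lbound; exists nu.
apply: le_ereal_inf_tmp => _ [nu nu_doubling <-].
have := @doubling_constant_star_ge nu ^~ nu_doubling.
(* The value [-oo] is excluded by taking [d = 0] in the lower bound, which would give
   [1 + Num.sqrt m <= 0]. *)
case: (doubling_constant nu) => [d /(_ d)|_|/(_ 0)]; rewrite ?leey//.
  by rewrite lee_fin; exact.
by rewrite leNye => /(_ isT); rewrite leNgt ltr_wpDr ?sqrtr_ge0.
Qed.

End Star.

(** * From cardinality and degrees to a list of leaves *)

Lemma star_graph_leaves (n : nat) (G : connected_graph) : star_graph n G ->
  exists (c : G) (leaves : seq G),
    [/\ uniq (c :: leaves), size leaves = n.-1,
        forall x, x != c -> x \in leaves,
        forall x, x != c -> adj c x &
        forall x y, x != c -> adj x y -> y = c].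
Proof.
move=> [cardG [c _ starG]].
have finG : finite_set [set: G] by apply/finite_setP; exists n.
pose s : seq G := finmap.enum_fset (fset_set [set: G]).
have us : uniq s by exact: finmap.fset_uniq.
have ins x : x \in s.
  by have := in_fset_set finG x; rewrite in_setT.
(* The leaves are an enumeration of all vertices with the centre removed, whence the length
   [n.-1]. *)
exists c, (seq.rem c s); split.
- by rewrite /= mem_rem_uniqF// rem_uniq.
- by rewrite size_rem// (card_fset_set cardG).
- by move=> x xc; rewrite mem_rem_uniq// inE xc ins.
- by move=> x /eqP/starG[].
- move=> x y /eqP/starG[cx /eq_cardSP[z _]].
  (* Degree 1 means that removing one neighbour [z] of [x] leaves no other. By symmetry of adjacency
     [c] is also a neighbour of [x], so [z] is [c]. *)
  rewrite II0 card_eq0 => /eqP xz.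
  have eqz u : adj x u -> u = z.
    by move=> xu; apply: contrapT => uz; have : set0 u by rewrite -xz.
  by move=> /eqz ->; apply/esym/eqz; rewrite adj_sym.
Qed.

Theorem proposition5p3 (R : realType) (n : nat) (hn : (2 <= n)%N)
    (S : connected_graph) (hS : star_graph n S) :
  graph_least_doubling_constant R S = (1 + Num.sqrt (n.-1)%:R)%:E.
Proof.
have [c [leaves [/= /andP[cl ul] sl ml ca la]]] := star_graph_leaves hS.
rewrite -sl; apply: (@least_doubling_constant_star _ _ c) => //.
by rewrite ltr0n sl -subn1 subn_gt0.
Qed.
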